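(* Let $n\ge1$ and let $X=\Gamma\backslash\mathbb{B}^n$, where $\Gamma\subset\mathrm{PU}(n,1)$ is a torsion-free non-uniform lattice whose parabolic stabilizers are unipotent. Let $d$ be the uniform depth of cusps of $X$, and put $s'=e^{\operatorname{sys}(X)/2}$. Then (whenever $s'\ge 2n$, so that the roots below are defined) $$d\ \ge\ \min\bigl\{(-2n+s')^{1/4},\ (-2n+s')^{1/2}\bigr\}.$$
   Context: $\mathbb{B}^n$ carries the Bergman metric of constant holomorphic sectional curvature $-1$, with distance $\operatorname{dist}$ and holomorphic isometry group $\mathrm{PU}(n,1)$. An element is parabolic if it has exactly one fixed point in $\overline{\mathbb{B}^n}$ and this point is on $\partial\mathbb{B}^n$; hyperbolic if it has exactly two fixed points in $\overline{\mathbb{B}^n}$, both on $\partial\mathbb{B}^n$. ''Parabolic stabilizers are unipotent'' means every parabolic element of $\Gamma$ is represented by a unipotent matrix in $\mathrm{U}(n,1)$. $\operatorname{sys}(X)=\inf\{\operatorname{dist}(z,\gamma z): z\in\mathbb{B}^n,\ \gamma\in\Gamma\text{ hyperbolic}\}$. Siegel model: $\mathbb{S}=\mathbb{C}^{n-1}\times\mathbb{R}\times\mathbb{R}_{>0}$ with coordinates $(\zeta,v,u)$, identified with $\mathbb{B}^n$ as the set of negative lines in $\mathbb{P}(\mathbb{C}^{n+1})$ for the Hermitian form $Q(z,w)=w^*J_0z$, $J_0=\begin{bmatrix}0&0&1\\0&I_{n-1}&0\\1&0&0\end{bmatrix}$, through $(\zeta,v,u)\mapsto\bigl[\tfrac12(-\|\zeta\|^2-u+iv):\zeta:1\bigr]$.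 The boundary point $q_\infty$ is $[1:0:0]$. Under this identification $\mathrm{PU}(n,1)=\mathrm{PU}(Q)$. A vertical translation by $t\in\mathbb{R}$ is the isometry $(\zeta,v,u)\mapsto(\zeta,v+t,u)$ fixing $q_\infty$; its length is $|t|$. Cusps: the cusps $c_1,\dots,c_k$ of $X$ are the $\Gamma$-orbits of boundary points fixed by a parabolic element of $\Gamma$. For each cusp $c_i$, conjugate $\Gamma$ in $\mathrm{PU}(Q)$ so that $c_i$ is represented by $q_\infty$, and let $\Gamma_i$ be the stabilizer of $q_\infty$ in $\Gamma$. Let $t_i>0$ be the length of a shortest nontrivial vertical translation in $\Gamma_i$ (it exists). For $\tilde u>0$ let $B_i(\tilde u)=\{(\zeta,v,u):u>\tilde u\}$. The height $u_i$ of $c_i$ is the smallest $\tilde u$ such that $\Gamma_i\backslash B_i(\tilde u)$ injects into $X$, and the depth of $c_i$ is $d_i=t_i/u_i$ (independent of the chosen conjugation). The uniform depth of cusps $d$ of $X$ is the largest number such that $d\le d_i$ for every $i$ (so each $\Gamma_i\backslash B_i(t_i/d)$ injects into $X$) and the images in $X$ of the sets $\Gamma_i\backslash B_i(t_i/d)$, $i=1,\dots,k$, are pairwise disjoint. *)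

(* Defs.v *)
From HB Require Import structures.
From mathcomp Require Import all_boot all_order all_algebra.
From mathcomp Require Import complex.
From mathcomp Require Import all_classical all_reals all_analysis.

Set Implicit Arguments.
Unset Strict Implicit.
Unset Printing Implicit Defensive.

Import Order.TTheory GRing.Theory Num.Theory.
Import numFieldNormedType.Exports.

Local Open Scope classical_set_scope.
Local Open Scope ring_scope.
Local Open Scope complex_scope.
Local Open Scope sesquilinear_scope.

(* The modulus topology on R[i], hence the entrywise one on matrices. *)
HB.instance Definition _ (R : realType) :=
  PseudoPointedMetric.copy R[i] (R[i])^o.

(* C^(n+1) split as 1 + (n-1) + 1, for n >= 1. *)
Notation hdim n := (1 + (n.-1 + 1))%N (only parsing).

Section HermitianModel.
Variables (R : realType) (n : nat).

Definition J0 : 'M[R[i]]_(hdim n) :=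
  block_mx 0 (row_mx 0 1%:M) (col_mx 0 1%:M) (block_mx 1%:M 0 0 0).

Definition herm (z w : 'cV[R[i]]_(hdim n)) : R[i] :=
  (w^t* *m J0 *m z) 0 0.

(* Points of projective space are represented by nonzero vectors, up to
   [same_line]. B^n is the set of negative lines and its boundary is the set
   of null lines; a real number is compared with 0 in the order of R[i], in
   which x < y forces x and y to have the same imaginary part. *)
Definition same_line (z w : 'cV[R[i]]_(hdim n)) : Prop :=
  exists2 c : R[i], c != 0 & w = c *: z.

Definition in_ball (z : 'cV[R[i]]_(hdim n)) : Prop := herm z z < 0.

Definition in_boundary (z : 'cV[R[i]]_(hdim n)) : Prop :=
  z != 0 /\ herm z z = 0.

Definition in_closed_ball (z : 'cV[R[i]]_(hdim n)) : Prop :=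
  z != 0 /\ herm z z <= 0.

Definition fixes (A : 'M[R[i]]_(hdim n)) (z : 'cV[R[i]]_(hdim n)) : Prop :=
  same_line z (A *m z).

Definition UQ : set 'M[R[i]]_(hdim n) :=
  [set A | forall z w, herm (A *m z) (A *m w) = herm z w].

Definition parabolic (A : 'M[R[i]]_(hdim n)) : Prop :=
  exists p, [/\ in_boundary p, fixes A p &
    forall q, in_closed_ball q -> fixes A q -> same_line p q].

Definition hyperbolic (A : 'M[R[i]]_(hdim n)) : Prop :=
  exists p q, [/\ in_boundary p /\ in_boundary q, ~ same_line p q,
    fixes A p /\ fixes A q &
    forall r, in_closed_ball r -> fixes A r ->
      same_line p r \/ same_line q r].

Definition unipotent (A : 'M[R[i]]_(hdim n)) : Prop :=
  exists k : nat, (A - 1) ^+ k = 0.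

(* The Bergman metric with holomorphic sectional curvature -1 is
   4 (|<v,z>|^2 - <z,z><v,v>) / <z,z>^2, evaluated on a tangent vector
   represented by v in C^(n+1) at a negative vector z. It only depends on the
   image of v in the tangent space of B^n at the line of z. For n = 1 this is
   4 |dz|^2 / (1 - |z|^2)^2 on the disc. *)
Definition bergman_norm (z v : 'cV[R[i]]_(hdim n)) : R :=
  Num.sqrt (complex.Re
    (4 * (`|herm v z| ^+ 2 - herm z z * herm v v) / herm z z ^+ 2)).

Definition C1 (f : R -> R) : Prop :=
  (forall t, derivable f t 1) /\ continuous (derive1 f).

Definition C1_path (c : R -> 'cV[R[i]]_(hdim n)) : Prop :=
  forall k, C1 (fun t => complex.Re (c t k 0)) /\
            C1 (fun t => complex.Im (c t k 0)).

Definition velocity (c : R -> 'cV[R[i]]_(hdim n)) (t : R) :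
    'cV[R[i]]_(hdim n) :=
  \col_k (derive1 (fun s => complex.Re (c s k 0)) t
          +i* derive1 (fun s => complex.Im (c s k 0)) t).

Definition path_length (c : R -> 'cV[R[i]]_(hdim n)) : R :=
  Rintegral (@lebesgue_measure R) `[0, 1]
    (fun t => bergman_norm (c t) (velocity c t)).

(* Riemannian distance of B^n; paths in B^n are given by C^1 lifts to negative
   vectors, the length being independent of the lift. *)
Definition dist (z w : 'cV[R[i]]_(hdim n)) : R :=
  inf [set x | exists c, [/\ C1_path c,
    forall t, 0 <= t <= 1 -> in_ball (c t),
    same_line z (c 0), same_line w (c 1) & x = path_length c]].

(* A subgroup of PU(Q) is given by its preimage in U(Q), that is, by a
   subgroup of U(Q) containing the scalars of modulus 1. *)
Record PU_subgroup (Gamma : set 'M[R[i]]_(hdim n)) : Prop := {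
  PU_subgroup_sub : Gamma `<=` UQ ;
  PU_subgroup_scalar : forall c : R[i], `|c| = 1 -> Gamma c%:M ;
  PU_subgroup_mul : forall A B, Gamma A -> Gamma B -> Gamma (A *m B) ;
  PU_subgroup_inv : forall A, Gamma A -> Gamma (invmx A) }.

(* Discreteness, torsion-freeness etc. refer to the image in PU(Q), where the
   class of A consists of its unit scalar multiples. *)
Definition discrete_in_PU (Gamma : set 'M[R[i]]_(hdim n)) : Prop :=
  forall A, Gamma A ->
    \forall B \near A, Gamma B -> exists c : R[i], B = c *: A.

Definition torsion_free (Gamma : set 'M[R[i]]_(hdim n)) : Prop :=
  forall A k, Gamma A -> is_scalar_mx (A ^+ k.+1) -> is_scalar_mx A.

(* U(Q)/Gamma is homeomorphic to PU(Q) modulo the image of Gamma. Its open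
   sets, seen in U(Q), are the relatively open sets stable under right
   multiplication by Gamma; they generate its Borel sigma-algebra. *)
Definition quotient_open (Gamma : set 'M[R[i]]_(hdim n)) :
    set (set 'M[R[i]]_(hdim n)) :=
  [set A | (exists2 O, open O & A = O `&` UQ) /\
           forall g h, A g -> Gamma h -> A (g *m h)].

(* U(Q)/Gamma carries a nonzero finite U(Q)-invariant Borel measure. *)
Definition finite_covolume (Gamma : set 'M[R[i]]_(hdim n)) : Prop :=
  exists mu : {measure set (g_sigma_algebraType (quotient_open Gamma))
                 -> \bar R},
    [/\ (0 < mu UQ)%E, (mu UQ < +oo)%E &
      forall g A, UQ g -> A `<=` UQ -> <<s quotient_open Gamma>> A ->
        mu (mulmx g @` A) = mu A].

Definition lattice (Gamma : set 'M[R[i]]_(hdim n)) : Prop :=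
  [/\ PU_subgroup Gamma, discrete_in_PU Gamma & finite_covolume Gamma].

(* Compactness of U(Q)/Gamma. *)
Definition uniform (Gamma : set 'M[R[i]]_(hdim n)) : Prop :=
  forall F : set (set 'M[R[i]]_(hdim n)),
    F `<=` quotient_open Gamma -> UQ `<=` \bigcup_(A in F) A ->
    exists F', [/\ F' `<=` F, finite_set F' & UQ `<=` \bigcup_(A in F') A].

Definition parabolic_stabilizers_unipotent
    (Gamma : set 'M[R[i]]_(hdim n)) : Prop :=
  forall A, Gamma A -> parabolic A ->
    exists2 c : R[i], `|c| = 1 & unipotent (c *: A).

Definition systole (Gamma : set 'M[R[i]]_(hdim n)) : R :=
  inf [set x | exists z A, [/\ in_ball z, Gamma A, hyperbolic A &
                               x = dist z (A *m z)]].

Definition siegel (zeta : 'cV[R[i]]_(n.-1)) (v u : R) :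
    'cV[R[i]]_(hdim n) :=
  col_mx (2^-1 * ((- u) +i* v - \sum_k `|zeta k 0| ^+ 2))%:M
         (col_mx zeta 1%:M).

Definition q_infty : 'cV[R[i]]_(hdim n) := col_mx 1%:M 0.

Definition horoball (u0 : R) : set 'cV[R[i]]_(hdim n) :=
  [set z | exists zeta v u, u0 < u /\ z = siegel zeta v u].

Definition vertical_translation (t : R) (A : 'M[R[i]]_(hdim n)) : Prop :=
  forall zeta v u, 0 < u ->
    same_line (A *m siegel zeta v u) (siegel zeta (v + t) u).

Definition stab_infty (Gamma : set 'M[R[i]]_(hdim n)) :
    set 'M[R[i]]_(hdim n) :=
  [set A | Gamma A /\ fixes A q_infty].

Definition shortest_vertical (Gamma : set 'M[R[i]]_(hdim n)) (t : R) : Prop :=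
  (exists A s, [/\ stab_infty Gamma A, vertical_translation s A, s != 0 &
                   t = `|s|]) /\
  forall A s, stab_infty Gamma A -> vertical_translation s A -> s != 0 ->
    t <= `|s|.

Definition horoball_injects (Gamma : set 'M[R[i]]_(hdim n)) (u0 : R) : Prop :=
  forall z w A, horoball u0 z -> horoball u0 w ->
    Gamma A -> same_line (A *m z) w ->
    exists2 B, stab_infty Gamma B & same_line (B *m z) w.

Definition height (Gamma : set 'M[R[i]]_(hdim n)) (u : R) : Prop :=
  [/\ 0 < u, horoball_injects Gamma u &
    forall u', 0 < u' -> horoball_injects Gamma u' -> u <= u'].

Definition depth (Gamma : set 'M[R[i]]_(hdim n)) (d : R) : Prop :=
  exists t u, [/\ shortest_vertical Gamma t, height Gamma u & d = t / u].

(* g moves q_infty to a boundary point fixed by a parabolic element of Gamma;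
   then g^-1 Gamma g is a conjugate of Gamma in which the corresponding cusp
   is represented by q_infty. *)
Definition cusp_frame (Gamma : set 'M[R[i]]_(hdim n))
    (g : 'M[R[i]]_(hdim n)) : Prop :=
  UQ g /\ exists A, [/\ Gamma A, parabolic A & fixes A (g *m q_infty)].

Definition conj_group (Gamma : set 'M[R[i]]_(hdim n))
    (g : 'M[R[i]]_(hdim n)) : set 'M[R[i]]_(hdim n) :=
  [set A | Gamma (g *m A *m invmx g)].

Definition same_cusp (Gamma : set 'M[R[i]]_(hdim n))
    (g h : 'M[R[i]]_(hdim n)) : Prop :=
  exists2 A, Gamma A & same_line (A *m (g *m q_infty)) (h *m q_infty).

Definition horoballs_meet (Gamma : set 'M[R[i]]_(hdim n))
    (g : 'M[R[i]]_(hdim n)) (u1 : R) (h : 'M[R[i]]_(hdim n)) (u2 : R) : Prop :=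
  exists z w A, [/\ horoball u1 z, horoball u2 w, Gamma A &
                    same_line (A *m (g *m z)) (h *m w)].

Definition depth_admissible (Gamma : set 'M[R[i]]_(hdim n)) (d : R) : Prop :=
  [/\ 0 < d,
    forall g, cusp_frame Gamma g ->
      exists2 di, depth (conj_group Gamma g) di & d <= di &
    forall g h t1 t2, cusp_frame Gamma g -> cusp_frame Gamma h ->
      ~ same_cusp Gamma g h ->
      shortest_vertical (conj_group Gamma g) t1 ->
      shortest_vertical (conj_group Gamma h) t2 ->
      ~ horoballs_meet Gamma g (t1 / d) h (t2 / d)].

Definition uniform_depth (Gamma : set 'M[R[i]]_(hdim n)) (d : R) : Prop :=
  depth_admissible Gamma d /\
  forall d', depth_admissible Gamma d' -> d' <= d.

End HermitianModel.

(* Main.v *)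
(* The stabilizer of a cusp contains a vertical translation; in terms of the
   form it is a transvection z |-> z + i s <z, p> p along a null vector p of the
   line of the cusp. If two horoballs overlap, the product of the transvections
   at their centres p and q, with parameters of opposite signs, is the identity
   on the orthogonal complement of span(p, q), and on span(p, q) it has
   eigenvalues l, 1/l with l + 1/l = 2 + k, where k = |s t| |<p, q>|^2 is bounded
   by the square of the depth of the horoballs. It is hyperbolic and translates
   its axis by 2 log l, whence exp (sys / 2) <= l < 2 + k. So horoballs of depth
   sqrt (exp (sys / 2) - 2) inject and are disjoint. *)
Require Import Defs.
From mathcomp Require Import all_boot all_order all_algebra.
From mathcomp Require Import complex.
From mathcomp Require Import all_classical all_reals all_analysis.
From mathcomp Require Import ring lra.
Import Order.TTheory GRing.Theory Num.Theory.
Import numFieldNormedType.Exports.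
Local Open Scope classical_set_scope.
Local Open Scope ring_scope.

Set Implicit Arguments.
Unset Strict Implicit.

(** * The Hermitian form *)

Section HermitianForm.
Context {R : realType} {n : nat}.
Local Notation C := (complex R).
Implicit Types (z w x y p q r : 'cV[C]_(hdim n)) (A B : 'M[C]_(hdim n)).

Definition first_coord z : C := z (lshift _ 0) 0.
Definition mid_coord z (k : 'I_n.-1) : C := z (rshift 1 (lshift 1 k)) 0.
Definition last_coord z : C := z (rshift 1 (rshift n.-1 0)) 0.

Lemma eq_coord z w : first_coord z = first_coord w ->
  (forall k, mid_coord z k = mid_coord w k) -> last_coord z = last_coord w ->
  z = w.
Proof.
move=> h1 h2 h3; apply/matrixP => i j; rewrite (ord1 j).
case: (split_ordP i) => [k ->|k ->]; first by rewrite (ord1 k).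
by case: (split_ordP k) => [l ->|l ->]; [exact: h2 | rewrite (ord1 l)].
Qed.

Lemma first_coord_col (a : 'cV[C]_1) (b : 'cV[C]_n.-1) (c : 'cV[C]_1) :
  first_coord (col_mx a (col_mx b c)) = a 0 0.
Proof. exact: col_mxEu. Qed.

Lemma mid_coord_col (a : 'cV[C]_1) (b : 'cV[C]_n.-1) (c : 'cV[C]_1) k :
  mid_coord (col_mx a (col_mx b c)) k = b k 0.
Proof. by rewrite /mid_coord col_mxEd col_mxEu. Qed.

Lemma last_coord_col (a : 'cV[C]_1) (b : 'cV[C]_n.-1) (c : 'cV[C]_1) :
  last_coord (col_mx a (col_mx b c)) = c 0 0.
Proof. by rewrite /last_coord !col_mxEd. Qed.

Lemma coordD z w : (first_coord (z + w) = first_coord z + first_coord w) *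
  (forall k, mid_coord (z + w) k = mid_coord z k + mid_coord w k) *
  (last_coord (z + w) = last_coord z + last_coord w).
Proof. by split; [split=> [|k]|]; rewrite /first_coord /mid_coord /last_coord mxE. Qed.

Lemma coordZ a z : (first_coord (a *: z) = a * first_coord z) *
  (forall k, mid_coord (a *: z) k = a * mid_coord z k) *
  (last_coord (a *: z) = a * last_coord z).
Proof. by split; [split=> [|k]|]; rewrite /first_coord /mid_coord /last_coord mxE. Qed.

Lemma coordN z : (first_coord (- z) = - first_coord z) *
  (forall k, mid_coord (- z) k = - mid_coord z k) *
  (last_coord (- z) = - last_coord z).
Proof. by split; [split=> [|k]|]; rewrite /first_coord /mid_coord /last_coord mxE. Qed.

Lemma hermE z w : herm z w =
  first_coord z * (last_coord w)^* + \sum_k mid_coord z k * (mid_coord w k)^*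
  + last_coord z * (first_coord w)^*.
Proof.
rewrite -[z]vsubmxK -[w]vsubmxK.
move: (usubmx z) (dsubmx z) (usubmx w) (dsubmx w) => z1 z2 w1 w2.
rewrite -[z2]vsubmxK -[w2]vsubmxK.
move: (usubmx z2) (dsubmx z2) (usubmx w2) (dsubmx w2) => z3 z4 w3 w4.
rewrite !(first_coord_col, last_coord_col).
under eq_bigr do rewrite !mid_coord_col.
rewrite /herm /J0 !(tr_col_mx, map_row_mx, mul_row_block) mul_row_col.
rewrite !(mulmx0, mulmx1, addr0, add0r) mul_mx_row mulmx0 mulmx1 add_row_mx.
rewrite addr0 add0r !mul_row_col mulmx0 mulmx1 add0r mulmxE.
rewrite !mxE !big_ord1 !mxE addrA; congr (_ + _ + _); rewrite 1?mulrC //.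
by apply: eq_bigr => k _; rewrite !mxE mulrC.
Qed.

Lemma hermDl x y z : herm (x + y) z = herm x z + herm y z.
Proof. by rewrite /herm mulmxDr mxE. Qed.

Lemma hermZl a x z : herm (a *: x) z = a * herm x z.
Proof. by rewrite /herm -scalemxAr mxE. Qed.

Lemma herm_conj z w : herm w z = (herm z w)^*.
Proof.
have -> : (herm z w)^* = (first_coord z)^* * last_coord w
    + \sum_k (mid_coord z k)^* * mid_coord w k + (last_coord z)^* * first_coord w.
  rewrite hermE !rmorphD !rmorphM /= !conjCK rmorph_sum; congr (_ + _ + _).
  by apply: eq_bigr => k _; rewrite rmorphM /= conjCK.
rewrite hermE addrC addrA [RHS]addrAC mulrC [X in _ + X + _]mulrC.
by congr (_ + _ + _); apply: eq_bigr => k _; rewrite mulrC.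
Qed.

Lemma hermDr x y z : herm z (x + y) = herm z x + herm z y.
Proof. by rewrite herm_conj hermDl rmorphD /= -!herm_conj. Qed.

Lemma hermZr a x z : herm z (a *: x) = a^* * herm z x.
Proof. by rewrite herm_conj hermZl rmorphM /= -herm_conj. Qed.

Lemma hermNl x z : herm (- x) z = - herm x z.
Proof. by rewrite -scaleN1r hermZl mulN1r. Qed.

Lemma hermNr x z : herm z (- x) = - herm z x.
Proof. by rewrite -scaleN1r hermZr rmorphN rmorph1 mulN1r. Qed.

Lemma herm0l z : herm 0 z = 0.
Proof. by rewrite -(scale0r z) hermZl mul0r. Qed.

Definition hermL := (hermDl, hermZl, hermNl, hermDr, hermZr, hermNr).

Lemma herm_UQ A z w : UQ A -> herm (A *m z) (A *m w) = herm z w.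
Proof. exact. Qed.

Lemma q_inftyE : [/\ first_coord (q_infty R n) = 1,
  forall k, mid_coord (q_infty R n) k = 0 & last_coord (q_infty R n) = 0].
Proof.
by rewrite /q_infty -col_mx0; split=> [|k|];
   rewrite (first_coord_col, mid_coord_col, last_coord_col) !mxE.
Qed.

Lemma herm_q_infty z : herm z (q_infty R n) = last_coord z.
Proof.
have [h1 h2 h3] := q_inftyE; rewrite hermE h1 h3 rmorph0 rmorph1 mulr0 mulr1.
by rewrite big1 ?add0r// => k _; rewrite h2 rmorph0 mulr0.
Qed.

Lemma q_infty_null : herm (q_infty R n) (q_infty R n) = 0.
Proof. by rewrite herm_q_infty; have [] := q_inftyE. Qed.

Lemma q_infty_neq0 : q_infty R n != 0.
Proof.
apply/eqP => h; have [+ _ _] := q_inftyE.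
by rewrite h /first_coord mxE => /eqP; rewrite eq_sym oner_eq0.
Qed.

Lemma last0_herm z : last_coord z = 0 ->
  herm z z = \sum_k `|mid_coord z k| ^+ 2.
Proof.
move=> h; rewrite hermE h rmorph0 mulr0 mul0r add0r addr0.
by apply: eq_bigr => k _; rewrite normCK.
Qed.

(** The last coordinate is the product with [q_infty]. Where it vanishes the form is a sum of
    squared moduli, so a nonpositive norm kills the middle coordinates. *)
Lemma last0_null z : last_coord z = 0 -> herm z z <= 0 ->
  z = first_coord z *: q_infty R n.
Proof.
move=> h; rewrite last0_herm// => h0.
have s0 : \sum_k `|mid_coord z k| ^+ 2 = 0.
  by apply/eqP; rewrite eq_le h0 sumr_ge0// => k _; rewrite exprn_ge0.
have [q1 q2 q3] := q_inftyE.
apply: eq_coord => [|k|]; rewrite coordZ.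
- by rewrite q1 mulr1.
- rewrite q2 mulr0; have := psumr_eq0P _ s0 => /(_ _ k isT).
  move=> /(_ (fun i _ => exprn_ge0 _ (normr_ge0 _)))/eqP.
  by rewrite expf_eq0 normr_eq0 /= => /eqP.
- by rewrite q3 mulr0 h.
Qed.

(* Subtracting a multiple of a null vector [x] from a vector orthogonal to [x]
   does not change its norm, so one may assume that its last coordinate
   vanishes. *)
Lemma orth_null_shift x r : in_boundary x -> herm r x = 0 ->
  exists a, herm (r - a *: x) (r - a *: x) = herm r r /\
    last_coord (r - a *: x) = 0.
Proof.
move=> [x0 xx] rx; have xr : herm x r = 0 by rewrite herm_conj rx rmorph0.
have lE a : last_coord (r - a *: x) = last_coord r - a * last_coord x.
  by rewrite coordD coordN coordZ.
(* If [x] lies on the line of [q_infty], orthogonality to [x] already gives [r] last coordinate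
   0. *)
have [x3|x3] := eqVneq (last_coord x) 0.
  exists 0; rewrite scale0r subr0; split=> //.
  have xE : x = first_coord x *: q_infty R n by apply: last0_null; rewrite ?xx.
  move: rx; rewrite xE hermZr herm_q_infty => /eqP; rewrite mulf_eq0 conjC_eq0.
  by case/orP => /eqP// x10; move: x0; rewrite xE x10 scale0r eqxx.
exists (last_coord r / last_coord x); rewrite lE divfK// subrr; split=> //.
by rewrite !hermL rx xr xx !(mulr0, oppr0, addr0).
Qed.

Lemma herm_orth_null x r : in_boundary x -> herm r x = 0 -> 0 <= herm r r.
Proof.
move=> bx rx; have [a [<- l0]] := orth_null_shift bx rx.
by rewrite last0_herm// sumr_ge0// => k _; rewrite exprn_ge0.
Qed.

(** After the shift, [r] becomes [b *: q_infty], still orthogonal to [x]. So either [b = 0], or [x]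
    itself spans the line of [q_infty]. *)
Lemma orth_null_line x r : in_boundary x -> herm r r <= 0 -> herm r x = 0 ->
  exists a, r = a *: x.
Proof.
move=> bx rr rx; have xr : herm x r = 0 by rewrite herm_conj rx rmorph0.
have [a [h l0]] := orth_null_shift bx rx; rewrite -h in rr.
have := last0_null l0 rr; set b := first_coord _ => rE.
have bl : b * (last_coord x)^* = 0.
  have : herm (r - a *: x) x = 0 by rewrite !hermL rx bx.2 mulr0 subrr.
  by rewrite rE hermZl herm_conj herm_q_infty.
move/eqP: bl; rewrite mulf_eq0 conjC_eq0 => /orP[/eqP b0|/eqP x3].
  by exists a; apply/eqP; rewrite -subr_eq0 rE b0 scale0r.
have xE : x = first_coord x *: q_infty R n by apply: last0_null; rewrite ?bx.2.
have x1 : first_coord x != 0.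
  by apply/eqP => x10; move: bx.1; rewrite xE x10 scale0r eqxx.
exists (a + b / first_coord x); rewrite scalerDl -[LHS](subrK (a *: x)) rE addrC.
by congr (_ + _); rewrite {2}xE scalerA divfK.
Qed.

(* [y] below is orthogonal to the null vector [p], hence has nonnegative norm. *)
Lemma herm_null_le p q z : in_boundary p -> in_boundary q -> herm z z < 0 ->
  `|herm p q| * - herm z z <= 2 * `|herm z p| * `|herm z q|.
Proof.
move=> bp bq zz; have [->|pq] := eqVneq (herm p q) 0.
  by rewrite normr0 mul0r !mulr_ge0.
have qp : herm q p != 0 by rewrite herm_conj conjC_eq0.
pose y := herm z p *: q - herm q p *: z.
have y_ge0 : 0 <= herm y y.
  by apply: (herm_orth_null bp); rewrite !hermL mulrC subrr.
(* [s] is the cross term in the expansion of [herm y y]. Bounding it by its modulus and cancelling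
   one factor [|<p, q>|] gives the claim. *)
set s := herm z p * (herm q p)^* * herm q z.
have yE : herm y y = `|herm p q| ^+ 2 * herm z z - (s + s^*).
  rewrite normCK /y !hermL bq.2 /s !rmorphM/= conjCK -!herm_conj.
  by move: (herm z p) (herm p z) (herm q p) (herm p q) (herm z q) (herm q z)
    (herm z z) => a a' b b' c c' e; ring.
have sN : `|s| = `|herm p q| * (`|herm z p| * `|herm z q|).
  rewrite /s -herm_conj [herm q z]herm_conj !normrM norm_conjC.
  by rewrite mulrA [X in X * _ = _]mulrC.
have : `|herm p q| * (`|herm p q| * - herm z z)
    <= `|herm p q| * (2 * `|herm z p| * `|herm z q|).
  have sle : - (s + s^*) <= `|s| + `|s|.
    have sR : s + s^* \is Num.real by rewrite CrealE rmorphD/= conjCK addrC.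
    apply: le_trans (real_ler_norm _) _; first by rewrite rpredN.
    by rewrite normrN (le_trans (ler_normD _ _))// norm_conjC.
  have -> : `|herm p q| * (2 * `|herm z p| * `|herm z q|) = `|s| + `|s|.
    by rewrite sN -mulrA mulr_natl mulrnAr mulr2n.
  apply: le_trans sle; rewrite -subr_ge0.
  by move: y_ge0; rewrite yE; congr (0 <= _); ring.
by rewrite ler_pM2l// normr_gt0.
Qed.

Lemma J0_sqr : J0 R n *m J0 R n = 1%:M.
Proof.
rewrite /J0 mulmx_block !(mul0mx, mulmx0, add0r, addr0).
rewrite mul_row_col mul_row_block mul_block_col mul_col_row mulmx_block.
rewrite !(mul0mx, mulmx0, mulmx1, add0r, addr0).
by rewrite add_block_mx !(add0r, addr0) row_mx0 col_mx0 -!scalar_mx_block.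
Qed.

(** Evaluated on basis vectors, unitarity reads [A^* J0 A = J0], and [J0] is an involution. *)
Lemma UQ_unit A : UQ A -> A \in unitmx.
Proof.
move=> UA.
suff : (A^T ^ Num.conj)%sesqui *m J0 R n *m A \in unitmx.
  by rewrite unitmx_mul => /andP[].
have -> : (A^T ^ Num.conj)%sesqui *m J0 R n *m A = J0 R n.
  apply/matrixP => i j.
  have := UA (delta_mx j 0) (delta_mx i 0); rewrite /herm.
  rewrite trmx_mul map_mxM !trmx_delta !map_delta_mx.
  rewrite -!mulmxA -!rowE ![row i _ _ _]mxE.
  by rewrite !mulmxA -!colE ![col _ _ _ _]mxE.
by case: (mulmx1_unit J0_sqr).
Qed.
End HermitianForm.

(** * Axes and the systole *)

Section Axis.
Context {R : realType}.
Local Notation C := (complex R).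

Lemma conj_real_complex (x : R) : ((x%:C)%C : C)^* = (x%:C)%C.
Proof. exact: conjc_real. Qed.

(** The real and imaginary parts of the coordinates of [axis] are functions of this shape, which
    differentiation preserves. *)
Lemma is_derive_exp_pair (a p q t : R) :
  is_derive t 1 (fun s : R => expR (a * s) * p + expR (- (a * s)) * q)
    (expR (a * t) * (a * p) + expR (- (a * t)) * (- a * q)).
Proof.
apply: is_derive_eq.
by rewrite !scaler0 !add0r -![_ *: _]/(_ * _) !mulr1; ring.
Qed.

Lemma derive1_exp_pair (a p q : R) :
  derive1 (fun s : R => expR (a * s) * p + expR (- (a * s)) * q) =
  (fun t => expR (a * t) * (a * p) + expR (- (a * t)) * (- a * q)).
Proof.
apply/funext => t; rewrite derive1E.
by have /@derive_val := is_derive_exp_pair a p q t.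
Qed.

Lemma C1_exp_pair (a p q : R) :
  C1 (fun s : R => expR (a * s) * p + expR (- (a * s)) * q).
Proof.
split=> [t|]; first by have /@ex_derive := is_derive_exp_pair a p q t.
rewrite derive1_exp_pair => t.
apply/differentiable_continuous/derivable1_diffP.
by have /@ex_derive := is_derive_exp_pair a (a * p) (- a * q) t.
Qed.

Variable n : nat.
Implicit Types (x y z w : 'cV[C]_(hdim n)) (M : 'M[C]_(hdim n)).

(** For null [x], [y] with [<x, y>] real and negative, this lifts a path along the geodesic joining
    their lines. For [0 <= a] its speed is [2 * a]. *)
Definition axis a x y (t : R) : 'cV[C]_(hdim n) :=
  ((expR (a * t))%:C)%C *: x + ((expR (- (a * t)))%:C)%C *: y.

Lemma Re_realM (r : R) (c : C) : complex.Re ((r%:C)%C * c) = r * complex.Re c.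
Proof. by case: c => u v /=; rewrite mul0r subr0. Qed.

Lemma Im_realM (r : R) (c : C) : complex.Im ((r%:C)%C * c) = r * complex.Im c.
Proof. by case: c => u v /=; rewrite mul0r addr0. Qed.

Lemma Re_axis a x y k : (fun t => complex.Re (axis a x y t k 0)) =
  (fun s => expR (a * s) * complex.Re (x k 0)
            + expR (- (a * s)) * complex.Re (y k 0)).
Proof. by apply/funext => t; rewrite !mxE raddfD /= !Re_realM. Qed.

Lemma Im_axis a x y k : (fun t => complex.Im (axis a x y t k 0)) =
  (fun s => expR (a * s) * complex.Im (x k 0)
            + expR (- (a * s)) * complex.Im (y k 0)).
Proof. by apply/funext => t; rewrite !mxE raddfD /= !Im_realM. Qed.

Lemma C1_axis a x y : C1_path (axis a x y).
Proof. by move=> k; rewrite Re_axis Im_axis; split; exact: C1_exp_pair. Qed.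

Lemma velocity_axis a x y t :
  velocity (axis a x y) t = axis a ((a%:C)%C *: x) ((- a)%:C%C *: y) t.
Proof.
apply/matrixP => k j; rewrite (ord1 j) mxE Re_axis Im_axis !derive1_exp_pair.
rewrite -!Re_realM -!Im_realM !mxE.
move: (x k 0) (y k 0) => [x1 x2] [y1 y2]; apply/eqP; rewrite eq_complex /=.
by apply/andP; split; apply/eqP; ring.
Qed.

Section Length.
Variables (a : R) (x y : 'cV[C]_(hdim n)) (N : R).
Hypotheses (a_ge0 : 0 <= a) (xx : herm x x = 0) (yy : herm y y = 0).
Hypotheses (N_gt0 : 0 < N) (xy : herm x y = (- N)%:C%C).

Let yx : herm y x = (- N)%:C%C.
Proof. by rewrite herm_conj xy conj_real_complex. Qed.

(** The exponentials cancel. With [b = a] and [c = - a] the left argument is the velocity, which is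
    thus orthogonal to the position. *)
Lemma herm_axis (b c : R) t :
  herm (axis a (b%:C%C *: x) (c%:C%C *: y) t) (axis a x y t) =
    (- N * (b + c))%:C%C.
Proof.
rewrite /axis !hermL !conj_real_complex xx yy xy yx.
rewrite !(mulr0, add0r, addr0) -!rmorphM -rmorphD; congr (_%:C)%C.
have := expRxMexpNx_1 (a * t); set e := expR _; set e' := expR _ => ee.
have -> : - N * (b + c) = - N * (b + c) * (e * e') by rewrite ee mulr1.
ring.
Qed.

(** Used with [b = c = 1] for the position and with [b = a], [c = - a] for the velocity. *)
Lemma herm_velocity (b c : R) t :
  herm (axis a (b%:C%C *: x) (c%:C%C *: y) t)
       (axis a (b%:C%C *: x) (c%:C%C *: y) t) = (- N * (2 * b * c))%:C%C.
Proof.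
rewrite /axis !hermL !conj_real_complex xx yy xy yx.
rewrite !(mulr0, add0r, addr0) -!rmorphM -rmorphD; congr (_%:C)%C.
have := expRxMexpNx_1 (a * t); set e := expR _; set e' := expR _ => ee.
have -> : - N * (2 * b * c) = - N * (2 * b * c) * (e * e') by rewrite ee mulr1.
ring.
Qed.

Lemma axis_in_ball t : in_ball (axis a x y t).
Proof.
have := herm_velocity 1 1 t; rewrite rmorph1 !scale1r /in_ball => ->.
rewrite -[0]/((0 : R)%:C)%C ltcR. by rewrite !mulr1 mulNr oppr_lt0 mulr_gt0.
Qed.

Lemma bergman_norm_axis t :
  bergman_norm (axis a x y t) (velocity (axis a x y) t) = 2 * a.
Proof.
rewrite /bergman_norm velocity_axis herm_axis herm_velocity.
have := herm_velocity 1 1 t; rewrite rmorph1 !scale1r => ->.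
rewrite subrr mulr0 normr0 expr2 mulr0 sub0r.
have -> : 4 * - ((- N * (2 * 1 * 1))%:C%C * (- N * (2 * a * - a))%:C%C)
   / (- N * (2 * 1 * 1))%:C%C ^+ 2 = ((2 * a) ^+ 2)%:C%C :> C.
  rewrite -[4]/(4%:R) -(rmorph_nat (real_complex R)).
  rewrite -rmorphM -rmorphN -rmorphM -rmorphXn -fmorphV -rmorphM.
  by congr (_%:C)%C; field; rewrite gt_eqF.
by rewrite sqrtr_sqr ger0_norm// mulr_ge0.
Qed.

Lemma path_length_axis : path_length (axis a x y) = 2 * a.
Proof.
rewrite /path_length.
under eq_Rintegral do rewrite bergman_norm_axis.
rewrite Rintegral_cst//.
have := lebesgue_measure_itv (`[0, 1] : interval R).
by rewrite /= lte_fin ltr01 => -> /=; rewrite oppr0 addr0 mulr1.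
Qed.

End Length.

Lemma path_length_ge0 (c : R -> 'cV[C]_(hdim n)) : 0 <= path_length c.
Proof. by apply: Rintegral_ge0 => t _; exact: sqrtr_ge0. Qed.

(** The empty set is covered too, its [inf] being 0 by convention. *)
Lemma inf_ge0 (E : set R) : lbound E 0 -> 0 <= inf E.
Proof.
have [->|E0] := eqVneq E set0; first by rewrite inf0.
by apply: lb_le_inf; exact/set0P.
Qed.

Lemma dist_ge0 z w : 0 <= dist z w.
Proof. by apply: inf_ge0 => _ [c [_ _ _ _ ->]]; exact: path_length_ge0. Qed.

Lemma dist_axis_le a x y (N : R) : 0 <= a ->
  herm x x = 0 -> herm y y = 0 -> 0 < N -> herm x y = (- N)%:C%C ->
  dist (axis a x y 0) (axis a x y 1) <= 2 * a.
Proof.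
move=> a0 xx yy N0 xy; apply: ge_inf.
  by exists 0 => _ [c [_ _ _ _ ->]]; exact: path_length_ge0.
exists (axis a x y); split; first exact: C1_axis.
- by move=> t _; exact: axis_in_ball xx yy N0 xy t.
- by exists 1; rewrite ?oner_neq0 ?scale1r.
- by exists 1; rewrite ?oner_neq0 ?scale1r.
- by rewrite (path_length_axis _ xx yy N0 xy).
Qed.

(** * Hyperbolic elements with two given null eigenvectors *)

Lemma herm_neq0_boundary_neq x y :
  in_boundary x -> herm x y != 0 -> ~ same_line x y.
Proof.
by move=> [_ xx] xy [c _ yE]; rewrite yE hermZr xx mulr0 eqxx in xy.
Qed.

Lemma same_line_of_multiple x y (a : C) : y != 0 -> y = a *: x -> same_line x y.
Proof.
move=> y0 yE; exists a => //; apply: contra y0 => /eqP a0.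
by rewrite yE a0 scale0r.
Qed.

(** Invariance of the form gives [<r, x> = m l^* <r, x>]. *)
Lemma UQ_fixed_orth M x r (l m : C) : UQ M -> M *m x = l *: x ->
  M *m r = m *: r -> m * l^* != 1 -> herm r x = 0.
Proof.
move=> UM Mx Mr ml; have := UM r x; rewrite Mx Mr hermZl hermZr => /eqP.
rewrite mulrA -subr_eq0 -{2}[herm r x]mul1r -mulrBl mulf_eq0 subr_eq0.
by rewrite (negPf ml) /= => /eqP.
Qed.

(** Let [r] be fixed with eigenvalue [m]. As [1 < l], the numbers [m l] and [m / l] are not both 1,
    so [r] is orthogonal to [x] or to [y]. Being nonpositive, it is then a multiple of that null
    vector. *)
Lemma hyperbolic_of_eigen M x y (l : R) : UQ M ->
  in_boundary x -> in_boundary y -> herm x y != 0 -> 1 < l ->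
  M *m x = l%:C%C *: x -> M *m y = l^-1%:C%C *: y -> hyperbolic M.
Proof.
move=> UM bx byy xy l1 Mx My; have l0 : l != 0 by rewrite gt_eqF// (lt_trans ltr01).
exists x, y; split=> //.
- exact: herm_neq0_boundary_neq.
- by split; [exists l%:C%C|exists l^-1%:C%C];
    rewrite // -[0]/((0 : R)%:C)%C (inj_eq (@complexI R)) ?invr_eq0.
move=> r [r0 rr] [m m0 Mr].
have [/eqP ml|ml] := boolP (m * (l%:C%C)^* == 1).
  have ml' : m * (l^-1%:C%C)^* != 1.
    apply/eqP; rewrite !conj_real_complex in ml * => ml'.
    have : (l^-1 * l^-1)%:C%C = 1%:C%C :> C.
      rewrite rmorphM -[LHS]mul1r -{1}ml [m * _]mulrC -mulrA [m * _]mulrA ml'.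
      by rewrite mul1r -rmorphM divff.
    move/complexI => /eqP; rewrite -expr2 exprVn invr_eq1 sqrf_eq1.
    by case/orP => /eqP h; move: l1; rewrite h ?ltxx// ltrNr; lra.
  right; have rO := UQ_fixed_orth UM My Mr ml'.
  have [a rE] := orth_null_line byy rr rO.
  exact: same_line_of_multiple rE.
have rO := UQ_fixed_orth UM Mx Mr ml.
by left; have [a rE] := orth_null_line bx rr rO; exact: same_line_of_multiple rE.
Qed.

Lemma systole_le (Gamma : set 'M[C]_(hdim n)) M x y (l : R) :
  Gamma M -> UQ M -> in_boundary x -> in_boundary y -> herm x y != 0 ->
  1 < l -> M *m x = l%:C%C *: x -> M *m y = l^-1%:C%C *: y ->
  expR (systole Gamma / 2) <= l.
Proof.
move=> GM UM bx byy xy l1 Mx My.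
have l0 : 0 < l by rewrite (lt_trans ltr01).
suff h : systole Gamma <= 2 * ln l.
  by rewrite -[leRHS](lnK l0) ler_expR ler_pdivrMr// mulrC.
pose N : R := complex.Re (`|herm x y| ^+ 2).
have NE : N%:C%C = `|herm x y| ^+ 2.
  by rewrite RRe_real// ger0_real// exprn_ge0.
have N0 : 0 < N.
  by rewrite -ltcR NE exprn_gt0// normr_gt0.
(* Rescaling [y] makes its product with [x] the negative real number [- N]. *)
pose y' := - herm x y *: y.
have xy' : herm x y' = (- N)%:C%C.
  by rewrite hermZr rmorphN /= rmorphN /= NE normCK mulNr mulrC.
have y'y' : herm y' y' = 0 by rewrite hermZl hermZr byy.2 !mulr0.
have a0 : 0 <= ln l by rewrite ln_ge0// ltW.
apply: le_trans (dist_axis_le a0 bx.2 y'y' N0 xy').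
apply: ge_inf.
  by exists 0 => _ [z [A [_ _ _ ->]]]; exact: dist_ge0.
exists (axis (ln l) x y' 0), M; split=> //.
- exact: axis_in_ball bx.2 y'y' N0 xy' 0.
- exact: hyperbolic_of_eigen Mx My.
(* With [a = ln l], the axis is at [x + y'] at time 0 and at [l x + l^-1 y'], the image under [M],
   at time 1. *)
- congr dist; rewrite /axis !mulr0 mulr1 oppr0 expR0 expRN lnK//.
  by rewrite !scale1r mulmxDr Mx -scalemxAr My !scalerA [_ * - _]mulrC.
Qed.

End Axis.

(** * Vertical translations *)

Section Transvection.
Context {R : realType} {n : nat}.
Local Notation C := (complex R).
Local Notation q_infty := (q_infty R n).
Implicit Types (x y z p q : 'cV[C]_(hdim n)) (A g : 'M[C]_(hdim n)).
Implicit Types (s t : R).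

Definition transvection p s : 'M[C]_(hdim n) :=
  1%:M + Complex 0 s *: (p *m ((p^T ^ Num.conj)%sesqui *m J0 R n)).

Lemma transvectionE p s z :
  transvection p s *m z = z + (Complex 0 s * herm z p) *: p.
Proof.
rewrite mulmxDl mul1mx -scalemxAl -mulmxA -scalerA; congr (_ + _ *: _).
by rewrite [X in _ *m X]mx11_scalar mul_mx_scalar.
Qed.

Lemma conj_imaginary s : (Complex 0 s : C)^* = - Complex 0 s.
Proof. by apply/eqP; rewrite eq_complex /= oppr0 !eqxx. Qed.

Lemma mulmx_ext A B : (forall z, A *m z = B *m z) -> A = B.
Proof.
by move=> h; apply/matrixP => i j; have := h (delta_mx j 0);
  rewrite -!colE => /matrixP/(_ i 0); rewrite !mxE.
Qed.

(** The two cross terms cancel because [Complex 0 s] is purely imaginary; the quadratic term carries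
    the factor [<p, p> = 0]. *)
Lemma transvection_UQ p s : herm p p = 0 -> UQ (transvection p s).
Proof.
move=> pp z w; rewrite !transvectionE !hermL pp rmorphM /= conj_imaginary.
rewrite [herm p w]herm_conj /=.
by move: (herm w p)^* (herm z p) (herm z w) (Complex 0 s) => a b c d; ring.
Qed.

Lemma transvection_conj g p s : UQ g ->
  g *m transvection p s *m invmx g = transvection (g *m p) s.
Proof.
move=> Ug; have gu := UQ_unit Ug; apply: mulmx_ext => z.
rewrite [RHS]transvectionE -2!mulmxA.
transitivity (g *m (invmx g *m z + (Complex 0 s * herm (invmx g *m z) p) *: p)).
  by congr (_ *m _); exact: transvectionE.
rewrite mulmxDr -scalemxAr.
by rewrite -(herm_UQ (invmx g *m z) p Ug) mulKVmx.
Qed.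

Lemma transvectionN p s : herm p p = 0 ->
  invmx (transvection p s) = transvection p (- s).
Proof.
move=> pp; have u := UQ_unit (transvection_UQ s pp).
apply: (can_inj (mulKmx u)); rewrite mulmxV//; apply: mulmx_ext => z.
rewrite -mulmxA !transvectionE !hermL pp mulr0 addr0 mul1mx.
rewrite -addrA -scalerDl -mulrDl.
have -> : Complex 0 (- s) + Complex 0 s = 0 :> C.
  by apply/eqP; rewrite eq_complex /= addr0 addNr eqxx.
by rewrite mul0r scale0r addr0.
Qed.

(** * Siegel coordinates and the matrices of vertical translations *)

Lemma siegel_coord (zeta : 'cV[C]_n.-1) v u :
  [/\ first_coord (siegel zeta v u) =
        2^-1 * (Complex (- u) v - \sum_k `|zeta k 0| ^+ 2),
      forall k, mid_coord (siegel zeta v u) k = zeta k 0 &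
      last_coord (siegel zeta v u) = 1].
Proof.
by split=> [|k|]; rewrite ?(first_coord_col, mid_coord_col, last_coord_col)// mxE.
Qed.

(** Siegel lifts are normalized by [<z, q_infty> = 1], so the height of a point is [- <z, z>] for
    this normalization. *)
Lemma herm_siegel (zeta : 'cV[C]_n.-1) v u :
  herm (siegel zeta v u) (siegel zeta v u) = (- u)%:C%C.
Proof.
have [h1 h2 h3] := siegel_coord zeta v u.
rewrite hermE h1 h3 rmorph1 mulr1 mul1r.
have -> : \sum_k mid_coord (siegel zeta v u) k * (mid_coord (siegel zeta v u) k)^* =
    \sum_k `|zeta k 0| ^+ 2 by apply: eq_bigr => k _; rewrite h2 normCK.
set S := \sum_k _; have SR : S^* = S.
  by apply: geC0_conj; rewrite sumr_ge0// => k _; rewrite exprn_ge0.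
rewrite rmorphM rmorphB /= SR fmorphV rmorph_nat.
have -> : (Complex (- u) v : C)^* = Complex (- u) v + (- Complex 0 v) *+ 2.
  apply/eqP; rewrite eq_complex /= !oppr0 !addr0 -opprD.
  by apply/andP; split=> //; apply/eqP; ring.
have -> : Complex (- u) v = (- u)%:C%C + Complex 0 v :> C.
  by apply/eqP; rewrite eq_complex /= addr0 add0r !eqxx.
move: (Complex 0 v) (- u)%:C%C S {SR} => a b c; by by field.
Qed.

(** The first coordinate of a Siegel lift contains [i v / 2], whence the parameter [t / 2]. *)
Lemma siegel_translate (zeta : 'cV[C]_n.-1) v u t :
  siegel zeta (v + t) u = transvection q_infty (t / 2) *m siegel zeta v u.
Proof.
have [q1 q2 q3] := @q_inftyE R n.
have [h1 h2 h3] := siegel_coord zeta v u.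
have [k1 k2 k3] := siegel_coord zeta (v + t) u.
rewrite transvectionE herm_q_infty h3 mulr1.
apply: eq_coord => [|k|]; rewrite coordD coordZ ?(h1, h2, h3) ?(q1, q2, q3);
  rewrite ?(k1, k2, k3) ?mulr1 ?mulr0 ?addr0//.
have -> : Complex (- u) (v + t) = Complex (- u) v + 2 * Complex 0 (t / 2) :> C.
  by apply/eqP; rewrite eq_complex /=; apply/andP; split; apply/eqP; field.
by field.
Qed.

Lemma herm_siegel0 y (zeta : 'cV[C]_n.-1) u :
  herm y (siegel zeta 0 u) = first_coord y
    + \sum_k mid_coord y k * (zeta k 0)^*
    - last_coord y * (2^-1 * (u%:C%C + \sum_k `|zeta k 0| ^+ 2)).
Proof.
have [h1 h2 h3] := siegel_coord zeta 0 u.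
rewrite hermE h1 h3 rmorph1 mulr1; under eq_bigr do rewrite h2.
congr (_ + _); rewrite -mulrN; congr (_ * _).
have SR : (\sum_k `|zeta k 0| ^+ 2)^* = \sum_k `|zeta k 0| ^+ 2.
  by apply: geC0_conj; rewrite sumr_ge0// => k _; rewrite exprn_ge0.
rewrite -[Complex _ _]/((- u)%:C%C) rmorphM rmorphB /= SR conj_real_complex.
by rewrite fmorphV rmorph_nat rmorphN -opprD mulrN.
Qed.

(** At [zeta = 0], two heights determine the last and first coordinates; taking basis vectors for
    [zeta] then kills the middle ones. *)
Lemma siegel_orth y : (forall zeta u, 0 < u -> herm y (siegel zeta 0 u) = 0) ->
  y = 0.
Proof.
move=> h; have h0 u : 0 < u -> first_coord y - last_coord y * (2^-1 * u%:C%C) = 0.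
  move=> u0; have := h 0 u u0; rewrite herm_siegel0.
  rewrite !big1 ?addr0// => k _; first by rewrite mxE normr0 expr0n.
  by rewrite mxE rmorph0 mulr0.
have y3 : last_coord y = 0.
  have e2 := h0 2 (ltr0Sn R 1); have e4 := h0 4 (ltr0Sn R 3).
  rewrite !rmorph_nat in e2 e4.
  have : first_coord y - last_coord y * (2^-1 * 2)
    - (first_coord y - last_coord y * (2^-1 * 4)) = 0 by rewrite e2 e4 subr0.
  by move: (first_coord y) (last_coord y) => a b <-; field.
have y1 : first_coord y = 0 by have := h0 1 ltr01; rewrite y3 mul0r subr0.
apply: eq_coord => [|k|];
  [by rewrite y1 /first_coord mxE| |by rewrite y3 /last_coord mxE].
rewrite [RHS]/mid_coord mxE.
have := h (delta_mx k 0) 1 ltr01; rewrite herm_siegel0 y1 y3 mul0r subr0 add0r.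
rewrite (bigD1 k)//= mxE !eqxx rmorph1 mulr1 big1 ?addr0// => j jk.
by rewrite mxE (negPf jk) rmorph0 mulr0.
Qed.

(** The product equals [- (1 + u + |zeta|^2) / 2]. *)
Lemma herm_siegel_neq0 (zeta : 'cV[C]_n.-1) u : 0 < u ->
  herm (siegel 0 0 1) (siegel zeta 0 u) != 0.
Proof.
move=> u0; have [h1 h2 h3] := siegel_coord 0 0 1.
rewrite herm_siegel0 h1 h3 -[Complex _ _]/((- 1)%:C%C) mul1r.
rewrite big1 => [|k _]; last by rewrite mxE normr0 expr0n.
rewrite big1 => [|k _]; last by rewrite h2 mxE mul0r.
rewrite subr0 addr0 -mulrBr mulf_neq0 ?invr_neq0 ?pnatr_eq0//.
rewrite rmorphN rmorph1 /= -opprD oppr_eq0 gt_eqF//.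
rewrite ltr_pwDl//; apply: addr_ge0; first by rewrite ler0c ltW.
by apply: sumr_ge0 => k _; rewrite exprn_ge0.
Qed.

(* Negative vectors are never orthogonal, so unitarity forces all the
   eigenvalues on Siegel vectors to agree. *)
Lemma scalar_of_fixes_siegel A : UQ A ->
  (forall zeta u, 0 < u -> fixes A (siegel zeta 0 u)) ->
  exists2 c : C, `|c| = 1 & A = c%:M.
Proof.
move=> UA fixA; have [c c0 cE] := fixA 0 1 ltr01.
have cc : c * c^* = 1.
  have := UA (siegel 0 0 1) (siegel 0 0 1); rewrite cE hermZl hermZr.
  have := herm_siegel_neq0 0 ltr01; set a := herm _ _ => a0 /eqP.
  rewrite mulrA -subr_eq0 -[X in _ - X]mul1r -mulrBl mulf_eq0 (negPf a0) orbF.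
  by rewrite subr_eq0 => /eqP.
exists c; first by apply/eqP; rewrite -sqrp_eq1// normCK cc.
(* Comparing with the base point [siegel 0 0 1] gives [c b^* = 1 = c c^*], so [b = c]. *)
have cE' zeta u : 0 < u -> A *m siegel zeta 0 u = c *: siegel zeta 0 u.
  move=> u0; have [b b0 bE] := fixA zeta u u0; rewrite bE; congr (_ *: _).
  have := UA (siegel 0 0 1) (siegel zeta 0 u); rewrite cE bE hermZl hermZr.
  have := herm_siegel_neq0 zeta u0; set a := herm _ _ => a0 /eqP.
  rewrite mulrA -subr_eq0 -[X in _ - X]mul1r -mulrBl mulf_eq0 (negPf a0) orbF.
  rewrite subr_eq0 => /eqP cb.
  by apply/(can_inj conjCK)/(mulfI c0); rewrite cb cc.
(* The difference [A z - c z] is orthogonal to all Siegel vectors with [v = 0]. *)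
apply: mulmx_ext => z; rewrite mul_scalar_mx; apply/eqP; rewrite -subr_eq0.
apply/eqP/siegel_orth => zeta u u0.
have := UA z (siegel zeta 0 u); rewrite cE'// !hermL => <-.
by rewrite mulrA cc mul1r subrr.
Qed.

(** [A] and the transvection act alike on Siegel points, so their quotient fixes those with [v = 0]
    and is a unit scalar. *)
Lemma vertical_translationE A t : UQ A -> vertical_translation t A ->
  exists2 c : C, `|c| = 1 & A = c *: transvection q_infty (t / 2).
Proof.
move=> UA vA; set V := transvection _ _.
have UV : UQ V by apply: transvection_UQ; exact: q_infty_null.
have uV := UQ_unit UV.
have UB : UQ (invmx V *m A).
  by move=> z w; rewrite -!mulmxA -UV !mulKVmx// UA.
have fB zeta u : 0 < u -> fixes (invmx V *m A) (siegel zeta 0 u).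
  move=> u0; have [c c0 cE] := vA zeta 0 u u0.
  exists c^-1; first by rewrite invr_eq0.
  apply: (can_inj (mulKmx uV)); rewrite -mulmxA mulKVmx// -scalemxAr.
  by rewrite -siegel_translate cE scalerA mulVf// scale1r.
have [c c1 cE] := scalar_of_fixes_siegel UB fB; exists c => //.
by rewrite -[A](mulKVmx uV) cE mul_mx_scalar.
Qed.

Lemma conj_group_UQ (Gamma : set 'M[C]_(hdim n)) g A :
  PU_subgroup Gamma -> UQ g -> conj_group Gamma g A -> UQ A.
Proof.
move=> GP Ug GA z w.
have XE x : g *m (A *m x) = (g *m A *m invmx g) *m (g *m x).
  by rewrite -!mulmxA mulKmx ?UQ_unit.
rewrite -(Ug (A *m z)) !XE -(Ug z).
exact: (PU_subgroup_sub GP GA).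
Qed.

(** The unit scalar is divided out inside [Gamma], and conjugation by [g] moves the centre from
    [q_infty] to the cusp. *)
Lemma conj_group_transvection (Gamma : set 'M[C]_(hdim n)) g A t :
  PU_subgroup Gamma -> UQ g -> conj_group Gamma g A -> vertical_translation t A ->
  Gamma (transvection (g *m q_infty) (t / 2)).
Proof.
move=> GP Ug GA vA; have UA := conj_group_UQ GP Ug GA.
have [c c1 cE] := vertical_translationE UA vA.
have c0 : c != 0 by rewrite -normr_eq0 c1 oner_neq0.
have : Gamma ((c^-1)%:M *m (g *m A *m invmx g)).
  by apply: PU_subgroup_mul => //; apply: PU_subgroup_scalar; rewrite // normfV c1 invr1.
rewrite mul_scalar_mx cE -scalemxAr -scalemxAl scalerA mulVf// scale1r.
by rewrite transvection_conj.
Qed.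

End Transvection.

(** * Products of two transvections *)

Section ProductOfTransvections.
Context {R : realType} {n : nat}.
Local Notation C := (complex R).
Implicit Types (x y z p q : 'cV[C]_(hdim n)) (A g : 'M[C]_(hdim n)).

Section Eigenvectors.
Variables (p q : 'cV[C]_(hdim n)) (a b N : R).
Hypotheses (pp : herm p p = 0) (qq : herm q q = 0).
Hypotheses (NE : N%:C%C = `|herm p q| ^+ 2) (N_gt0 : 0 < N) (b0 : b != 0).

(** An eigenvector, in the span of [p] and [q], of the product of the transvections with parameters
    [a] at [p] and [b] at [q], when [m] is a root of the characteristic polynomial in
    [eigenvectorP]. *)
Definition eigenvector (m : R) : 'cV[C]_(hdim n) :=
  (m - 1)%:C%C *: p + (Complex 0 b * herm p q) *: q.

Let NE' : herm p q * herm q p = N%:C%C.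
Proof. by rewrite NE normCK -herm_conj. Qed.

Lemma imaginaryM (s t : R) : Complex 0 s * Complex 0 t = (- (s * t))%:C%C :> C.
Proof.
by apply/eqP; rewrite eq_complex /= !mul0r !mulr0 sub0r addr0 !eqxx.
Qed.

Lemma eigenvectorP (m : R) : m ^+ 2 - (2 - a * b * N) * m + 1 = 0 ->
  (transvection p a *m transvection q b) *m eigenvector m =
  m%:C%C *: eigenvector m.
Proof.
move=> mE; rewrite -mulmxA.
(* The inner transvection only multiplies the coefficient of [q] by [m]. *)
have E : transvection q b *m eigenvector m =
    (m - 1)%:C%C *: p + (m%:C%C * (Complex 0 b * herm p q)) *: q.
  rewrite [LHS]transvectionE /eigenvector !hermL qq mulr0 addr0 -addrA -scalerDl.
  congr (_ + _ *: _); rewrite rmorphB rmorph1 /=.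
  by move: (Complex 0 b) (herm p q) => c d; ring.
transitivity (transvection p a *m
    ((m - 1)%:C%C *: p + (m%:C%C * (Complex 0 b * herm p q)) *: q)).
  by congr (_ *m _).
rewrite [LHS]transvectionE !hermL pp mulr0 add0r addrAC -scalerDl /eigenvector.
rewrite scalerDr !scalerA; congr (_ *: _ + _).
have -> : Complex 0 a * (m%:C%C * (Complex 0 b * herm p q) * herm q p) =
  (Complex 0 a * Complex 0 b) * m%:C%C * (herm p q * herm q p).
  by move: (Complex 0 a) (Complex 0 b) (herm p q) (herm q p) => c d e f; ring.
(* For the coefficient of [p] it remains that [m - 1 - a b N m = m (m - 1)], which is the
   characteristic equation. *)
rewrite NE' imaginaryM -!rmorphM -rmorphD; congr (_%:C)%C.
by apply/eqP; rewrite -subr_eq0 -oppr_eq0 -mE; apply/eqP; ring.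
Qed.

(** Equal parameters give a null vector; distinct ones, such as [l] and [l^-1], give a nonzero
    product if [b] and [N] are nonzero. *)
Lemma herm_eigenvector (m m' : R) :
  herm (eigenvector m) (eigenvector m') = Complex 0 (b * N * (m' - m)).
Proof.
rewrite /eigenvector !hermL pp qq !rmorphM /= conj_imaginary conj_real_complex.
rewrite -herm_conj !mulr0 add0r addr0.
have -> : (Complex 0 (b * N * (m' - m)) : C) =
    Complex 0 b * N%:C%C * (m'%:C%C - m%:C%C).
  by apply/eqP; rewrite eq_complex /=; apply/andP; split; apply/eqP; ring.
rewrite -NE' !rmorphB rmorph1 /=.
by move: (Complex 0 b) (herm p q) (herm q p) => c d e; ring.
Qed.

Lemma eigenvector_boundary (m : R) : in_boundary (eigenvector m).
Proof.
split; last by rewrite herm_eigenvector subrr mulr0.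
(* The product of the eigenvector with [p] is [i b N], which is nonzero. *)
apply/eqP => x0; have : herm (eigenvector m) p = 0 by rewrite x0 herm0l.
rewrite /eigenvector !hermL pp mulr0 add0r -mulrA NE' => /eqP.
have -> : Complex 0 b * N%:C%C = Complex 0 (b * N).
  by apply/eqP; rewrite eq_complex /=; apply/andP; split; apply/eqP; ring.
by rewrite eq_complex /= eqxx mulf_eq0 (negPf b0) gt_eqF.
Qed.

End Eigenvectors.

(** [l] is the larger root by the quadratic formula. The polynomial is palindromic, so [l^-1] is a
    root as well. *)
Lemma reciprocal_roots (k : R) : 0 < k ->
  exists l, [/\ 1 < l, l < 2 + k, l ^+ 2 - (2 + k) * l + 1 = 0 &
    l^-1 ^+ 2 - (2 + k) * l^-1 + 1 = 0].
Proof.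
move=> k0; pose r := Num.sqrt ((2 + k) ^+ 2 - 4); pose l := (2 + k + r) / 2.
have r2 : r ^+ 2 = (2 + k) ^+ 2 - 4 by rewrite sqr_sqrtr//; nra.
have r0 : 0 <= r by exact: sqrtr_ge0.
have lE : l ^+ 2 - (2 + k) * l + 1 = 0.
  have -> : l ^+ 2 - (2 + k) * l + 1 = (r ^+ 2 - ((2 + k) ^+ 2 - 4)) / 4.
    by rewrite /l; field.
  by rewrite r2 subrr mul0r.
have l1 : 1 < l by rewrite /l; lra.
have ll : l != 0 by rewrite gt_eqF// (lt_trans ltr01).
exists l; split=> //; first by rewrite /l; nra.
have -> : l^-1 ^+ 2 - (2 + k) * l^-1 + 1 = (l ^+ 2 - (2 + k) * l + 1) / l ^+ 2.
  by field.
by rewrite lE mul0r.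
Qed.

(** For [a * b < 0] the trace [2 - a b N] on the span of [p] and [q] exceeds 2. It also exceeds the
    larger eigenvalue [l], which bounds the systole. *)
Lemma systole_transvections_neg (Gamma : set 'M[C]_(hdim n)) p q (a b : R) :
  PU_subgroup Gamma -> in_boundary p -> in_boundary q -> herm p q != 0 ->
  Gamma (transvection p a) -> Gamma (transvection q b) -> a * b < 0 ->
  (expR (systole Gamma / 2))%:C%C < 2 + (- (a * b))%:C%C * `|herm p q| ^+ 2 :> C.
Proof.
move=> GP bp bq pq Gp Gq ab.
pose N : R := complex.Re (`|herm p q| ^+ 2).
have NE : N%:C%C = `|herm p q| ^+ 2.
  by rewrite RRe_real// ger0_real// exprn_ge0.
have N0 : 0 < N by rewrite -ltcR NE exprn_gt0// normr_gt0.
have b0 : b != 0 by apply/eqP => b0; rewrite b0 mulr0 ltxx in ab.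
have [l [l1 l2 lE lE']] : exists l : R, [/\ 1 < l, l < 2 + - (a * b) * N,
    l ^+ 2 - (2 + - (a * b) * N) * l + 1 = 0 &
    l^-1 ^+ 2 - (2 + - (a * b) * N) * l^-1 + 1 = 0].
  by apply: reciprocal_roots; rewrite mulr_gt0// oppr_gt0.
rewrite -NE -(rmorph_nat (real_complex R)) -rmorphM -rmorphD ltcR.
apply: le_lt_trans l2; rewrite mulNr in lE lE'.
pose x := eigenvector p q b.
have GM : Gamma (transvection p a *m transvection q b).
  exact: PU_subgroup_mul.
apply: (systole_le GM (PU_subgroup_sub GP GM)
  (eigenvector_boundary bp.2 bq.2 NE N0 b0 l)
  (eigenvector_boundary bp.2 bq.2 NE N0 b0 l^-1) _ l1
  (eigenvectorP bp.2 bq.2 NE lE) (eigenvectorP bp.2 bq.2 NE lE')).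
rewrite (herm_eigenvector _ bp.2 bq.2 NE) eq_complex /= eqxx /=.
rewrite !mulf_neq0//; first by rewrite gt_eqF.
by rewrite subr_eq0 lt_eqF// (lt_trans _ l1)// invf_lt1// (lt_trans ltr01).
Qed.

(** If [a] and [b] have the same sign, the transvection at [q] is replaced by its inverse, of
    parameter [- b]. *)
Lemma systole_transvections (Gamma : set 'M[C]_(hdim n)) p q (a b : R) :
  PU_subgroup Gamma -> in_boundary p -> in_boundary q -> herm p q != 0 ->
  Gamma (transvection p a) -> Gamma (transvection q b) -> a * b != 0 ->
  (expR (systole Gamma / 2))%:C%C < 2 + `|a * b|%:C%C * `|herm p q| ^+ 2 :> C.
Proof.
move=> GP bp bq pq Gp Gq ab.
have [ab0|ab0] := ltP (a * b) 0.
  by rewrite (ltr0_norm ab0); exact: systole_transvections_neg.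
have Gq' : Gamma (transvection q (- b)).
  by rewrite -transvectionN ?bq.2//; exact: PU_subgroup_inv.
have ab' : a * - b < 0 by rewrite mulrN oppr_lt0 lt_neqAle eq_sym ab.
have := systole_transvections_neg GP bp bq pq Gp Gq' ab'.
by rewrite mulrN opprK (ger0_norm ab0).
Qed.

(** [u] and [u'] are the heights of one point seen from [p] and from [q]; the factor [k] passes
    between the two normalized lifts. [herm_null_le] gives [|k| |<p, q>| u <= 2], and [u' = |k|^2 u]
    turns its square into the claim. *)
Lemma herm_null_heights_le p q z (k : C) (u u' : R) :
  in_boundary p -> in_boundary q -> 0 < u ->
  herm z p = 1 -> herm z z = (- u)%:C%C ->
  herm (k *: z) q = 1 -> herm (k *: z) (k *: z) = (- u')%:C%C ->
  `|herm p q| ^+ 2 * (u * u')%:C%C <= 4.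
Proof.
move=> bp bq u0 zp zz; rewrite !hermL zz => zq kzz.
have zlt : herm z z < 0 by rewrite zz -[0]/((0 : R)%:C)%C ltcR oppr_lt0.
have := herm_null_le bp bq zlt; rewrite zp zz normr1 mulr1.
rewrite -rmorphN opprK => le2.
have k0 : k != 0 by apply/eqP => k0; move/eqP: zq; rewrite k0 mul0r eq_sym oner_eq0.
have u'E : u'%:C%C = `|k| ^+ 2 * u%:C%C.
  have : (- u')%:C%C = `|k| ^+ 2 * (- u)%:C%C by rewrite normCK -mulrA -kzz.
  by rewrite !rmorphN mulrN => /oppr_inj.
have kzq : `|k| * `|herm z q| = 1 by rewrite -normrM zq normr1.
have : `|k| * (`|herm p q| * u%:C%C) <= 2.
  have -> : 2 = `|k| * (2 * `|herm z q|) by rewrite mulrCA kzq mulr1.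
  by rewrite ler_pM2l ?normr_gt0.
have -> : `|herm p q| ^+ 2 * (u * u')%:C%C = (`|k| * (`|herm p q| * u%:C%C)) ^+ 2.
  rewrite rmorphM /= u'E.
  by move: `|k| `|herm p q| => c d; ring.
have -> : 4 = 2 ^+ 2 :> C by rewrite -natrX.
move=> h; rewrite ler_pXn2r// ?nnegrE ?mulr_ge0// ler0c ltW//.
Qed.

End ProductOfTransvections.

(** * Cusps *)

Section Cusps.
Context {R : realType} {n : nat}.
Local Notation C := (complex R).
Local Notation q_infty := (q_infty R n).
Implicit Types (x y z w p q : 'cV[C]_(hdim n)) (A g h : 'M[C]_(hdim n)).
Variable Gamma : set 'M[C]_(hdim n).
Hypothesis GP : PU_subgroup Gamma.

Lemma UQ_boundary g p : UQ g -> in_boundary p -> in_boundary (g *m p).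
Proof.
move=> Ug [p0 pp]; split; last by rewrite herm_UQ.
by apply: contra_neq p0 => gp0; rewrite -[p](mulKmx (UQ_unit Ug)) gp0 mulmx0.
Qed.

Lemma q_infty_boundary : in_boundary q_infty.
Proof. by split; [exact: q_infty_neq0 | exact: q_infty_null]. Qed.

Lemma UQ_mul A B : UQ A -> UQ B -> UQ (A *m B).
Proof. by move=> UA UB z w; rewrite -!mulmxA UA UB. Qed.

Lemma subgroup_transvection A p (a : R) :
  Gamma A -> Gamma (transvection p a) -> Gamma (transvection (A *m p) a).
Proof.
move=> GA Gp; rewrite -transvection_conj; last exact: (PU_subgroup_sub GP GA).
apply: PU_subgroup_mul => //; last exact: PU_subgroup_inv.
exact: PU_subgroup_mul.
Qed.

Lemma horoball_last (u : R) z : horoball u z ->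
  last_coord z = 1 /\ exists2 u', u < u' & herm z z = (- u')%:C%C.
Proof.
move=> [zeta [v [u' [uu' ->]]]]; have [_ _ ->] := siegel_coord zeta v u'.
by split=> //; exists u' => //; exact: herm_siegel.
Qed.

(** A common point has heights above [|s| / d] and [|t| / d], so [|<p, q>|^2 |s t| <= 4 d^2] for the
    centres [p], [q]. The 4 cancels against the halved parameters of the transvections. *)
Lemma horoballs_meet_systole g h (s t d : R) z w :
  UQ g -> UQ h -> 0 < d -> s != 0 -> t != 0 ->
  Gamma (transvection (g *m q_infty) (s / 2)) ->
  Gamma (transvection (h *m q_infty) (t / 2)) ->
  horoball (`|s| / d) z -> horoball (`|t| / d) w ->
  same_line (g *m z) (h *m w) ->
  herm (g *m q_infty) (h *m q_infty) != 0 ->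
  expR (systole Gamma / 2) < 2 + d ^+ 2.
Proof.
move=> Ug Uh d0 s0 t0 Gg Gh /horoball_last[zl [u su zz]].
move=> /horoball_last[wl [u' tu ww]] [k k0 kE] pq.
have s0' : 0 < `|s| by rewrite normr_gt0.
have t0' : 0 < `|t| by rewrite normr_gt0.
have su0 : 0 < `|s| / d by rewrite divr_gt0.
have tu0 : 0 < `|t| / d by rewrite divr_gt0.
have bg := UQ_boundary Ug q_infty_boundary.
have bh := UQ_boundary Uh q_infty_boundary.
have u0 : 0 < u by exact: lt_trans su.
have u'0 : 0 < u' by exact: lt_trans tu.
have le4 : `|herm (g *m q_infty) (h *m q_infty)| ^+ 2 * (u * u')%:C%C <= 4.
  apply: (@herm_null_heights_le _ _ _ _ (g *m z) k) => //.
  - by rewrite herm_UQ// herm_q_infty.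
  - by rewrite herm_UQ.
  - by rewrite -kE herm_UQ// herm_q_infty.
  - by rewrite -kE herm_UQ.
have st0 : s / 2 * (t / 2) != 0 by rewrite !mulf_neq0// invr_neq0// pnatr_eq0.
have := systole_transvections GP bg bh pq Gg Gh st0.
move: le4; pose N : R := complex.Re (`|herm (g *m q_infty) (h *m q_infty)| ^+ 2).
have NE : `|herm (g *m q_infty) (h *m q_infty)| ^+ 2 = N%:C%C.
  by rewrite RRe_real// ger0_real// exprn_ge0.
rewrite NE -!(rmorph_nat (real_complex R)) -!rmorphM -rmorphD lecR ltcR.
have -> : `|s / 2 * (t / 2)| = `|s| * `|t| / 4.
  by rewrite !normrM normfV (ger0_norm (ler0n _ 2)); field.
move=> le4 /lt_le_trans; apply; rewrite lerD2l.
have : (`|s| / d) * (`|t| / d) <= u * u' by rewrite ler_pM// ltW.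
move=> le_uu.
have uu0 : 0 < u * u' by rewrite mulr_gt0.
have N0 : 0 <= N by rewrite -ler0c -NE exprn_ge0.
have st : `|s| * `|t| <= d ^+ 2 * (u * u').
  have -> : `|s| * `|t| = d ^+ 2 * ((`|s| / d) * (`|t| / d)).
    by field; rewrite gt_eqF.
  by rewrite ler_pM2l// exprn_gt0.
have : `|s| * `|t| * N <= d ^+ 2 * (u * u') * N by rewrite ler_wpM2r.
have : d ^+ 2 * (N * (u * u')) <= d ^+ 2 * 4 by rewrite ler_pM2l// exprn_gt0.
rewrite (mulrC N) mulrA => h1 h2; have := le_trans h2 h1.
by rewrite -ler_pdivrMr// mulrAC.
Qed.

Lemma depth_admissible_of_systole (d d' : R) : depth_admissible Gamma d ->
  0 < d' -> 2 + d' ^+ 2 <= expR (systole Gamma / 2) ->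
  depth_admissible Gamma d'.
Proof.
move=> [d0 Gd _] d'0 sys; split=> //.
  move=> g cg; have Ug := cg.1; have gu := UQ_unit Ug.
  have [di [t [u [tP uP diE]]] ddi] := Gd g cg; exists di; first by exists t, u.
  have [[T [s [[GT _] sT s0 tE]]] _] := tP.
  have t0 : 0 < t by rewrite tE normr_gt0.
  have [u0 _ umin] := uP.
  (* If [t / u < d'], then [t / d' < u], so injectivity at height [t / d'] contradicts the
     minimality of [u]. *)
  rewrite diE leNgt; apply/negP => tud'.
  have tdu : t / d' < u by rewrite ltr_pdivrMr// mulrC -ltr_pdivrMr.
  suff /umin : horoball_injects (conj_group Gamma g) (t / d').
    by rewrite leNgt tdu => /(_ (divr_gt0 t0 d'0)).
  move=> z w A hz hw GA [k k0 kE].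
  (* This coordinate is [<A q_infty, q_infty>]. If it vanishes, [A] fixes [q_infty] and belongs to
     the stabilizer. *)
  have [last0|last0] := eqVneq (last_coord (A *m q_infty)) 0.
    exists A; last by exists k.
    split=> //; have UA := conj_group_UQ GP Ug GA.
    have bA := UQ_boundary UA q_infty_boundary.
    apply: same_line_of_multiple (last0_null last0 _); first exact: bA.1.
    by rewrite bA.2.
  exfalso; have UA := conj_group_UQ GP Ug GA.
  have Gs := conj_group_transvection GP Ug GT sT.
  (* Otherwise, conjugation inside [Gamma] gives a transvection of the same parameter at the second
     centre [g A q_infty]. *)
  have GAs : Gamma (transvection (g *m A *m q_infty) (s / 2)).
    have -> : g *m A *m q_infty = (g *m A *m invmx g) *m (g *m q_infty).
      by rewrite -!mulmxA mulKmx.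
    exact: subgroup_transvection.
  have := @horoballs_meet_systole (g *m A) g s s d' z w.
  rewrite -tE -!mulmxA => /(_ (UQ_mul Ug UA) Ug d'0 s0 s0).
  rewrite !mulmxA => /(_ GAs Gs hz hw).
  rewrite -!mulmxA herm_UQ// herm_q_infty.
  move=> /(_ _ last0); rewrite ltNge sys => /(_ _)/negP; apply => //.
  by exists k => //; rewrite kE [RHS]scalemxAr.
move=> g h t1 t2 cg ch nsame [[T1 [s1 [[GT1 _] sT1 s10 ->]]] _].
move=> [[T2 [s2 [[GT2 _] sT2 s20 ->]]] _] [z [w [A [hz hw GA line]]]].
have Ug := cg.1; have Uh := ch.1; have UA := PU_subgroup_sub GP GA.
have G1 := subgroup_transvection GA (conj_group_transvection GP Ug GT1 sT1).
have G2 := conj_group_transvection GP Uh GT2 sT2.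
(* Replacing [g] by [A *m g] puts the common point in both horoballs without a further group
   element. *)
have := @horoballs_meet_systole (A *m g) h s1 s2 d' z w.
rewrite -!mulmxA => /(_ (UQ_mul UA Ug) Uh d'0 s10 s20 G1 G2 hz hw line).
rewrite ltNge sys => hm; apply: nsame; exists A => //.
have bg := UQ_boundary UA (UQ_boundary Ug q_infty_boundary).
have bh := UQ_boundary Uh q_infty_boundary.
(* Orthogonal null vectors are proportional, so orthogonal centres would represent the same cusp. *)
have [pq|/hm//] := eqVneq (herm (A *m (g *m q_infty)) (h *m q_infty)) 0.
have [a aE] : exists a, h *m q_infty = a *: (A *m (g *m q_infty)).
  by apply: orth_null_line; rewrite ?bh.2// herm_conj pq rmorph0.
exact: same_line_of_multiple bh.1 aE.
Qed.

End Cusps.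

(** * The lower bound for the uniform depth *)

Unset Implicit Arguments.
Set Strict Implicit.
Local Open Scope complex_scope.

Theorem theorem3p14 (R : realType) (n : nat) (n_ge1 : (1 <= n)%N)
    (Gamma : set 'M[R[i]]_(hdim n))
    (Gamma_lattice : lattice Gamma)
    (Gamma_torsion_free : torsion_free Gamma)
    (Gamma_non_uniform : ~ uniform Gamma)
    (Gamma_unipotent : parabolic_stabilizers_unipotent Gamma)
    (d : R) (d_uniform_depth : uniform_depth Gamma d)
    (s' : R) (s'_def : s' = expR (systole Gamma / 2))
    (s'_ge : 2 * n%:R <= s') :
  Num.min ((- 2 * n%:R + s') `^ (1 / 4)) ((- 2 * n%:R + s') `^ (1 / 2)) <= d.
Proof.
have [dP dmax] := d_uniform_depth; have [GP _ _] := Gamma_lattice.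
(* The minimum is bounded through its second term, the square root. *)
rewrite ge_min; apply/orP; right.
have x0 : 0 <= - 2 * n%:R + s' by rewrite mulNr addrC subr_ge0.
rewrite div1r powR12_sqrt//; set r := Num.sqrt _.
rewrite leNgt; apply/negP => dr; have r0 : 0 < r by have [/lt_trans->] := dP.
have : depth_admissible Gamma r.
  apply: (depth_admissible_of_systole GP dP r0).
  (* Here [2 + r^2 = 2 - 2 n + s'], which is at most [s'] because [1 <= n]. So [r] would be an
     admissible depth larger than [d]. *)
  rewrite -s'_def sqr_sqrtr// addrA -[leRHS]add0r lerD2r.
  have : 1 <= n%:R :> R by rewrite ler1n.
  lra.
by move/dmax; rewrite leNgt dr.
Qed.
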